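(* Consider a sequence of $T$ $n$-player games $(\mathcal G^{(t)})_{1\le t\le T}$ (as described in the context) such that $\mathcal G^{(t)}$ is $(\lambda^{(t)},\mu^{(t)})$-smooth with optimal social welfare $\mathrm{OPT}^{(t)}$ and Lipschitz parameter $L^{(t)}$. Let $L:=\max_{1\le t\le T}L^{(t)}$. If in every game all players use optimistic gradient descent (OGD) for $m$ iterations with learning rate $\eta=\frac{1}{4L\sqrt{n-1}}$ and initialization $x_k^{(t,0)}:=\frac1{t-1}\sum_{s<t}\mathring x_k^{(s)}$ for $t\ge2$ and $k\in\{1,\dots,n\}$, then $$\frac1{mT}\sum_{t=1}^T\sum_{i=1}^m\mathrm{SW}(x^{(t,i)})\ge\frac1T\sum_{t=1}^T\frac{\lambda^{(t)}}{1+\mu^{(t)}}\mathrm{OPT}^{(t)}-\frac{2L\sqrt{n-1}}{m}\sum_{k=1}^nV_k^2-\widetilde O\left(\frac1{mT}\right),$$ where $x^{(t,i)}=(x_1^{(t,i)},\dots,x_n^{(t,i)})$ is the strategy profile produced by the players at iteration $i$ of game $t$, and $\mathrm{SW}(x^{(t,i)})$ is its social welfare in game $\mathcal G^{(t)}$.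
   Context: Games: there are $n\ge2$ players; player $k$ picks $x_k$ from a nonempty convex compact set $\mathcal X_k\subset\mathbb R^{d_k}$ (the same in all games). In each game the utilities are multilinear, $u_k(x)=\langle x_k,u_k(x_{-k})\rangle$ with $u_k(x_{-k})\in\mathbb R^{d_k}$, $\|u_k(x_{-k})\|_\infty\le1$. $L^{(t)}>0$ is such that in game $t$, $\|u_k(x_{-k})-u_k(x_{-k}')\|_2\le L^{(t)}\|x_{-k}-x_{-k}'\|_2$ for all $k$, $x_{-k}$, $x_{-k}'$. Social welfare: $\mathrm{SW}(x)=\sum_{k=1}^nu_k(x)$, $\mathrm{OPT}=\max_x\mathrm{SW}(x)$. A game is $(\lambda,\mu)$-smooth, $\lambda,\mu>0$, if there is a profile $x^\star\in\prod_k\mathcal X_k$ with $\sum_{k=1}^nu_k(x_k^\star,x_{-k})\ge\lambda\,\mathrm{OPT}-\mu\,\mathrm{SW}(x)$ for all $x\in\prod_k\mathcal X_k$. OGD in game $t$ for player $k$, started at $x_k^{(t,0)}$: $\hat x_k^{(t,0)}=x_k^{(t,0)}$; with $u_k^{(t,i)}:=u_k(x_{-k}^{(t,i)})$ computed in game $t$ for $i\ge0$, for $i=1,\dots,m$: $x_k^{(t,i)}=\mathrm{Proj}_{\mathcal X_k}(\hat x_k^{(t,i-1)}+\eta u_k^{(t,i-1)})$, $\hat x_k^{(t,i)}=\mathrm{Proj}_{\mathcal X_k}(\hat x_k^{(t,i-1)}+\eta u_k^{(t,i)})$ (Euclidean projections). In game 1, $x_k^{(1,0)}=\arg\min_{x_k\in\mathcal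 X_k}\frac12\|x_k\|_2^2$. $\mathring x_k^{(t)}\in\arg\max_{x_k\in\mathcal X_k}\sum_{i=1}^m\langle x_k,u_k^{(t,i)}\rangle$ is the optimum in hindsight (ties broken by a fixed rule), and $V_k^2:=\frac1T\min_{x_k\in\mathcal X_k}\sum_{t=1}^T\|\mathring x_k^{(t)}-x_k\|_2^2$. $\widetilde O(1/(mT))$ denotes a quantity at most $\frac{C\,\mathrm{polylog}(T)}{mT}$, where $C$ depends polynomially on the natural parameters ($n$, $L$, and the $\ell_2$-diameters of the $\mathcal X_k$) but not on $m,T$. *)

(* Defs.v *)
From HB Require Import structures.
From mathcomp Require Import all_boot all_order all_algebra.
From mathcomp Require Import all_classical all_reals all_analysis.

Set Implicit Arguments.
Unset Strict Implicit.
Unset Printing Implicit Defensive.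

Import Order.TTheory GRing.Theory Num.Theory.
Import numFieldNormedType.Exports.

Local Open Scope classical_set_scope.
Local Open Scope ring_scope.

Section euclidean.
Context {R : realType}.

Definition dot (d : nat) (u v : 'rV[R]_d) : R := \sum_(i < d) u 0 i * v 0 i.

(* The library's norm on ['rV[R]_d] is the sup norm, hence a separate
   definition. *)
Definition norm2 (d : nat) (u : 'rV[R]_d) : R := Num.sqrt (dot u u).

Definition argmin (d : nat) (A : set 'rV[R]_d) (f : 'rV[R]_d -> R) :
    set 'rV[R]_d :=
  [set x | A x /\ forall y, A y -> f x <= f y].

Definition argmax (d : nat) (A : set 'rV[R]_d) (f : 'rV[R]_d -> R) :
    set 'rV[R]_d :=
  [set x | A x /\ forall y, A y -> f y <= f x].

(* For a nonempty closed convex [A] the minimizer exists and is unique, so the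
   default value and the choice made by [xget] do not matter. *)
Definition proj (d : nat) (A : set 'rV[R]_d) (y : 'rV[R]_d) : 'rV[R]_d :=
  xget 0 (argmin A (fun x => norm2 (x - y))).

Definition diam (d : nat) (A : set 'rV[R]_d) : R :=
  sup [set norm2 (p.1 - p.2) | p in A `*` A].

End euclidean.

Section games.
Context {R : realType} {n : nat} (d : 'I_n -> nat).

Definition profile := forall k : 'I_n, 'rV[R]_(d k).

(* [others k] is the type of the profiles $x_{-k}$. *)
Definition others (k : 'I_n) :=
  forall j : {j : 'I_n | j != k}, 'rV[R]_(d (val j)).

Definition drop_player (x : profile) (k : 'I_n) : others k :=
  fun j => x (val j).
Arguments drop_player : clear implicits.

Definition others_dist (k : 'I_n) (y z : others k) : R :=
  Num.sqrt (\sum_(j : {j : 'I_n | j != k}) norm2 (y j - z j) ^+ 2).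

(* A game is given by its utility vectors: [G k y] is $u_k(x_{-k})$ for
   $x_{-k}$ = [y]. *)
Definition game := forall k : 'I_n, others k -> 'rV[R]_(d k).

Definition utility_vec (G : game) (x : profile) (k : 'I_n) : 'rV[R]_(d k) :=
  G k (drop_player x k).

Definition utility (G : game) (k : 'I_n) (x : profile) : R :=
  dot (x k) (utility_vec G x k).

Definition welfare (G : game) (x : profile) : R :=
  \sum_(k < n) utility G k x.

Variable X : forall k : 'I_n, set 'rV[R]_(d k).
Arguments X : clear implicits.

Definition profiles : set profile := [set x | forall k, X k (x k)].

Definition others_in (k : 'I_n) : set (others k) :=
  [set y | forall j, X (val j) (y j)].

(* Linearity in each player's strategy separately. Since [f] only matters on
   the product of the strategy sets, linearity in player [j]'s strategy means
   that, the other strategies being fixed, [f] coincides on [X j] with a linear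
   functional [dot^~ w]. *)
Definition multilinear (f : profile -> R) : Prop :=
  forall (j : 'I_n) (x : profile), profiles x ->
    exists w : 'rV[R]_(d j), forall y : 'rV[R]_(d j), X j y ->
      f (dfwith x j y) = dot y w.

Definition valid_game (G : game) : Prop :=
  (forall k, multilinear (utility G k)) /\
  (forall k (y : others k), others_in y -> forall i, `|G k y 0 i| <= 1).

Definition lipschitz_game (G : game) (L : R) : Prop :=
  0 < L /\
  forall k (y z : others k), others_in y -> others_in z ->
    norm2 (G k y - G k z) <= L * others_dist y z.

(* The supremum is a maximum when the game is Lipschitz and the strategy sets
   are nonempty and compact. *)
Definition OPT (G : game) : R := sup [set welfare G x | x in profiles].

Definition smooth (G : game) (lam mu : R) : Prop :=
  [/\ 0 < lam, 0 < mu &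
    exists2 xstar : profile, profiles xstar &
      forall x, profiles x ->
        lam * OPT G - mu * welfare G x <=
          \sum_(k < n) dot (xstar k) (utility_vec G x k)].

(* [ogd G eta x0 i] is the pair $(x^{(i)}, \hat x^{(i)})$. *)
Fixpoint ogd (G : game) (eta : R) (x0 : profile) (i : nat) :
    profile * profile :=
  if i is i'.+1 then
    let: (x, xhat) := ogd G eta x0 i' in
    let x' : profile :=
      fun k => proj (X k) (xhat k + eta *: utility_vec G x k) in
    (x', fun k => proj (X k) (xhat k + eta *: utility_vec G x' k))
  else (x0, x0).

(* A fixed rule selecting a maximizer over [X k] from the objective function,
   whenever there is one. *)
Definition tie_breaking
    (tie : forall k : 'I_n, ('rV[R]_(d k) -> R) -> 'rV[R]_(d k)) : Prop :=
  forall k f, argmax (X k) f !=set0 -> argmax (X k) f (tie k f).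

(* $V_k^2$ for the hindsight optima [opt 1], ..., [opt T]. *)
Definition deviation2 (T : nat) (opt : nat -> profile) (k : 'I_n) : R :=
  T%:R^-1 *
  inf [set \sum_(1 <= t < T.+1) norm2 (opt t k - y) ^+ 2 | y in X k].

Definition max_diam : R := \big[Num.max/0]_(k < n) diam (X k).

End games.

Definition eval3 {R : realType} (P : {poly {poly {poly R}}}) (a b c : R) : R :=
  P.[a%:P%:P].[b%:P].[c].

(* Main.v *)
Require Import Defs.
From mathcomp Require Import all_boot all_order all_algebra.
From mathcomp Require Import all_classical all_reals all_analysis.
From mathcomp Require Import ring lra.

Set Implicit Arguments.
Unset Strict Implicit.
Unset Printing Implicit Defensive.

Import Order.TTheory GRing.Theory Num.Theory.
Import numFieldNormedType.Exports.

Local Open Scope classical_set_scope.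
Local Open Scope ring_scope.

(** In each game, the prox inequalities of optimistic gradient descent bound the
    players' total regret against any profile [z] by
    [sum_k |z_k - x_k^(0)|^2 / (2 eta)]: the prediction errors
    [u^(i) - u^(i-1)] are controlled by the Lipschitz property and absorbed by
    the movement terms, thanks to the choice of [eta]. With [z] the optimum in
    hindsight, smoothness turns this into a welfare guarantee. The
    initializations are the iterates of follow-the-leader for the quadratic
    losses [|opt^(t)_k - .|^2], so their cumulative loss exceeds [T V_k^2] by at
    most [diam^2 (1 + ln T)]. *)

(** * Euclidean inner product: bilinearity, elementary inequalities, continuity *)

Section dot_theory.
Context {R : realType} {d : nat}.
Implicit Types u v w : 'rV[R]_d.

Lemma dotC u v : dot u v = dot v u.
Proof. by apply: eq_bigr => i _; rewrite mulrC. Qed.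

Lemma dotDl u v w : dot (u + v) w = dot u w + dot v w.
Proof. by rewrite -big_split; apply: eq_bigr => i _; rewrite mxE mulrDl. Qed.

Lemma dotZl (a : R) u w : dot (a *: u) w = a * dot u w.
Proof. by rewrite mulr_sumr; apply: eq_bigr => i _; rewrite mxE mulrA. Qed.

Lemma dotNl u w : dot (- u) w = - dot u w.
Proof. by rewrite -scaleN1r dotZl mulN1r. Qed.

Lemma dotDr u v w : dot w (u + v) = dot w u + dot w v.
Proof. by rewrite dotC dotDl !(dotC w). Qed.

Lemma dotZr (a : R) u w : dot w (a *: u) = a * dot w u.
Proof. by rewrite dotC dotZl dotC. Qed.

Lemma dotNr u w : dot w (- u) = - dot w u.
Proof. by rewrite dotC dotNl dotC. Qed.

Definition dotE := (dotDl, dotDr, dotNl, dotNr, dotZl, dotZr).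

Lemma dot_sumr I (r : seq I) (F : I -> 'rV[R]_d) u :
  dot u (\sum_(i <- r) F i) = \sum_(i <- r) dot u (F i).
Proof.
elim/big_rec2: _ => [|i x y _ <-]; last by rewrite dotDr.
by rewrite -(scale0r 0) dotZr mul0r.
Qed.

Lemma dot_ge0 u : 0 <= dot u u.
Proof. by apply: sumr_ge0 => i _; rewrite -expr2 sqr_ge0. Qed.

Lemma norm2_sqr u : norm2 u ^+ 2 = dot u u.
Proof. by rewrite sqr_sqrtr ?dot_ge0. Qed.

Lemma norm2_ge0 u : 0 <= norm2 u.
Proof. exact: sqrtr_ge0. Qed.

(** Expand the square of [c *: u - 2^-1 *: v]. The weight [4^-1] is half of the [2^-1] available in
    a prox inequality, so a quarter of the movement term survives. *)
Lemma dot_young (c : R) u v :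
  c * dot u v <= c ^+ 2 * dot u u + 4^-1 * dot v v.
Proof.
have := dot_ge0 (c *: u - 2^-1 *: v).
rewrite !dotE (dotC v u); lra.
Qed.

Lemma dot_parallelogram_le u v w :
  dot (u - w) (u - w) <= 2 * (dot (u - v) (u - v) + dot (v - w) (v - w)).
Proof.
have := dot_ge0 ((u - v) - (v - w)).
rewrite !dotE (dotC v u) (dotC w u) (dotC w v); lra.
Qed.

Lemma continuous_coord_sum (F : 'I_d -> 'rV[R]_d -> R) :
  (forall i, continuous (F i)) -> continuous (fun u => \sum_i F i u).
Proof.
move=> cF u; have -> : (fun u => \sum_i F i u) = \sum_i F i.
  by rewrite fct_sumE.
elim/big_ind: _ => [|f g cf cg|i _]; last exact: cF.
  exact: cst_continuous.
exact: continuousD.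
Qed.

Lemma dotr_continuous v : continuous (fun u => dot u v).
Proof.
apply: continuous_coord_sum => i u.
by apply: continuousM; [exact: coord_continuous|exact: cst_continuous].
Qed.

Lemma sqdist_continuous v : continuous (fun u => dot (u - v) (u - v)).
Proof.
apply: continuous_coord_sum => i u.
have c : {for u, continuous (fun u : 'rV[R]_d => (u - v) 0 i)}.
  have -> : (fun u : 'rV[R]_d => (u - v) 0 i) = (fun u => u 0 i - v 0 i).
    by apply/funext => w; rewrite !mxE.
  by apply: continuousB; [exact: coord_continuous|exact: cst_continuous].
exact: continuousM.
Qed.

End dot_theory.

(** * Projections, prox inequalities and means in a convex compact set *)

Section convex_compact.
Context {R : realType} {d : nat} {A : set 'rV[R]_d}.
Hypotheses (A0 : A !=set0) (cA : compact A).

Lemma argmax_linear_neq0 v : argmax A (fun y => dot y v) !=set0.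
Proof.
have [|c cinA cmax] := @EVT_max_rV R d (fun y => dot y v) A A0 cA.
  by apply: continuous_subspaceT; exact: dotr_continuous.
exists c; split; first exact/set_mem.
by move=> y /mem_set; exact: cmax.
Qed.

Lemma projP z : argmin A (fun x => norm2 (x - z)) (Defs.proj A z).
Proof.
apply: xgetPex.
have [|c cinA cmin] := @EVT_min_rV R d (fun x => dot (x - z) (x - z)) A A0 cA.
  by apply: continuous_subspaceT; exact: sqdist_continuous.
exists c; split; first exact/set_mem.
by move=> y /mem_set /cmin; exact: ler_wsqrtr.
Qed.

Lemma proj_in z : A (Defs.proj A z).
Proof. by have [] := projP z. Qed.

Lemma norm2_le_diam x y : A x -> A y -> norm2 (x - y) <= diam A.
Proof.
(* A supremum bounds the distances only once they are known to be bounded: with [c] a point of [A]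
   of largest norm, |u - v|^2 <= 2(|u|^2 + |v|^2) <= 4|c|^2. *)
move=> Ax Ay; apply: ub_le_sup; last by exists (x, y).
have [|c cinA cmax] := @EVT_max_rV R d (fun x => dot (x - 0) (x - 0)) A A0 cA.
  by apply: continuous_subspaceT; exact: sqdist_continuous.
exists (Num.sqrt (4 * dot (c - 0) (c - 0))) => _ [[u v] /= [Au Av] <-].
apply: ler_wsqrtr.
have := dot_parallelogram_le u 0 v.
have := cmax _ (mem_set Au); have := cmax _ (mem_set Av).
have -> : dot (0 - v) (0 - v) = dot (v - 0) (v - 0).
  by rewrite sub0r subr0 dotNl dotNr opprK.
lra.
Qed.

Lemma sqdist_le_diam x y : A x -> A y -> dot (x - y) (x - y) <= diam A ^+ 2.
Proof.
move=> Ax Ay; rewrite -norm2_sqr ler_sqr ?nnegrE ?norm2_ge0 ?norm2_le_diam//.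
exact: le_trans (norm2_ge0 _) (norm2_le_diam Ax Ay).
Qed.

Hypothesis convA : @convex_set R 'rV[R]_d A.

Lemma convex_segment x y (t : R) :
  A x -> A y -> 0 <= t <= 1 -> A (x + t *: (y - x)).
Proof.
move=> /mem_set Ax /mem_set Ay t01.
have /set_mem := @convA y x (Itv01 (andP t01).1 (andP t01).2) Ay Ax.
congr A; rewrite /conv/= /unstable.onem; apply/rowP => i; rewrite !mxE; ring.
Qed.

(** First-order optimality of the projection [p]: if the angle at [p] between [y] and [z] were
    acute, a small move from [p] towards [y] would come closer to [z]. *)
Lemma proj_variational z y :
  A y -> dot (y - Defs.proj A z) (z - Defs.proj A z) <= 0.
Proof.
move=> Ay; have [] := projP z; set p := Defs.proj A z => Ap pmin.
set a := dot _ _; rewrite leNgt; apply/negP => a0.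
set b := dot (y - p) (y - p).
have b0 : 0 <= b := dot_ge0 _.
have ab0 : 0 < b + a by rewrite ltr_wpDl.
(* A move of length [t] changes the squared distance by t(tb - 2a). This [t] lies in (0, 1] even
   when [b = 0], and tb = a - ta < 2a makes the change negative. *)
pose t := a / (b + a).
have t0 : 0 < t by rewrite divr_gt0.
have t1 : t <= 1 by rewrite ler_pdivrMr// mul1r lerDr.
have /pmin : A (p + t *: (y - p)) by apply: convex_segment => //; rewrite ltW.
rewrite -ler_sqr ?nnegrE ?norm2_ge0// !norm2_sqr.
have -> : p + t *: (y - p) - z = t *: (y - p) - (z - p).
  by apply/rowP => i; rewrite !mxE; ring.
have -> : p - z = - (z - p) by rewrite opprB.
move: (z - p) (y - p) @a @b a0 b0 ab0 @t t0 t1 => r q a b a0 b0 ab0 t t0 t1.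
rewrite !dotE (dotC r q) -/a -/b.
have tb : t * b = a - t * a by rewrite /t; field; rewrite gt_eqF.
nra.
Qed.

(** The variational inequality at [p], with the product of [y - p] and [p - h] rewritten by the law
    of cosines; the squared distances to [y] telescope along the iterations. *)
Lemma proj_step (c : R) h u y (p := Defs.proj A (h + c *: u)) : A y ->
  c * dot (y - p) u <=
    2^-1 * (dot (y - h) (y - h) - dot (y - p) (y - p) - dot (p - h) (p - h)).
Proof.
move=> /(proj_variational (h + c *: u)); rewrite -/p; move: p => p.
rewrite !dotE (dotC p h) (dotC p y) (dotC h y); lra.
Qed.

(* The two prox inequalities at the half step [x] and at the full step [h'],
   together with Young's inequality for the prediction error [u1 - u0]. *)
Lemma optimistic_step (c : R) h u0 u1 y
    (x := Defs.proj A (h + c *: u0)) (h' := Defs.proj A (h + c *: u1)) : A y ->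
  c * dot (y - x) u1 <=
    2^-1 * (dot (y - h) (y - h) - dot (y - h') (y - h'))
    + c ^+ 2 * dot (u1 - u0) (u1 - u0)
    - 4^-1 * dot (h' - x) (h' - x) - 2^-1 * dot (x - h) (x - h).
Proof.
move=> Ay.
have := proj_step c h u1 Ay.
have := proj_step c h u0 (proj_in (h + c *: u1)).
have := dot_young c (u1 - u0) (h' - x).
rewrite -/x -/h'; move: x h' => x h'.
rewrite !dotE (dotC u1 h') (dotC u0 h') (dotC u1 x) (dotC u0 x).
rewrite (dotC x h') (dotC h h'); lra.
Qed.

(** Adding a point moves the mean along the segment to that point, by the inverse of the new number
    of points. This makes the averaged initializations feasible. *)
Lemma convex_mean (a : nat -> 'rV[R]_d) t : (0 < t)%N ->
  (forall s, (1 <= s <= t)%N -> A (a s)) ->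
  A (t%:R^-1 *: \sum_(1 <= s < t.+1) a s).
Proof.
elim: t => // -[_ _ aA|t IH _ aA].
  by rewrite big_nat1 invr1 scale1r; exact: aA.
have Am : A (t.+1%:R^-1 *: \sum_(1 <= s < t.+2) a s).
  by apply: IH => // s /andP[s1 st]; apply: aA; rewrite s1 leqW.
have := @convex_segment _ (a t.+2) t.+2%:R^-1 Am.
rewrite invr_ge0 ler0n invf_le1 ?ltr0n// ler1n/= => /(_ (aA _ _) isT).
rewrite ltnS leqnn => /(_ isT); congr A.
rewrite (big_nat_recr t.+2)//=; move: (\sum_(_ <= _ < _) _) (a _) => S b.
apply/rowP => i; rewrite !mxE -[t.+2%:R]natr1; field.
by rewrite (addrC 1) !natr1 !pnatr_eq0.
Qed.

End convex_compact.

(** * Follow-the-leader for quadratic losses *)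

Section follow_the_leader.
Context {R : realType}.

(** Each new term 1/N is at most ln N - ln(N - 1), by ln(1 + x) <= x at x = -1/N. *)
Lemma harmonic_le_ln T : (0 < T)%N ->
  \sum_(1 <= t < T.+1) t%:R^-1 <= 1 + ln T%:R :> R.
Proof.
elim: T => // -[_ _|T IH _]; first by rewrite big_nat1 invr1 ln1 addr0.
rewrite big_nat_recr//= (le_trans (lerD (IH isT) (lexx _)))// -addrA lerD2l.
have T0 : 0 < T.+1%:R :> R by rewrite ltr0n.
have S0 : 0 < T.+2%:R :> R by rewrite ltr0n.
have /le_ln1Dx : -1 < - T.+2%:R^-1 :> R.
  by rewrite ltrN2 invf_lt1// ltr1n.
have -> : 1 - T.+2%:R^-1 = T.+1%:R / T.+2%:R :> R.
  by rewrite -[T.+2%:R]natr1; field; rewrite (addrC 1) !natr1 gt_eqF.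
rewrite ln_div ?posrE//; move: (ln _) (ln _) _^-1 => p q r; lra.
Qed.

Context {d : nat}.

(* The induction carries the term [t |y - mean|^2], i.e. the gap between the
   cost of [y] and that of the leader. *)
Lemma follow_the_leader_quadratic (a w : nat -> 'rV[R]_d) (D2 : R) T y :
  (forall t, (1 <= t <= T)%N -> dot (a t - w t) (a t - w t) <= D2) ->
  (forall t, (2 <= t <= T)%N ->
    w t = (t%:R - 1)^-1 *: \sum_(1 <= s < t) a s) ->
  \sum_(1 <= t < T.+1) dot (a t - w t) (a t - w t) <=
    \sum_(1 <= t < T.+1) dot (a t - y) (a t - y)
    + D2 * \sum_(1 <= t < T.+1) t%:R^-1.
Proof.
move=> aD wE.
pose c t := t%:R^-1 *: \sum_(1 <= s < t.+1) a s.
suff H t : (t <= T)%N ->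
    \sum_(1 <= s < t.+1) dot (a s - w s) (a s - w s)
      + t%:R * dot (y - c t) (y - c t) <=
    \sum_(1 <= s < t.+1) dot (a s - y) (a s - y)
      + D2 * \sum_(1 <= s < t.+1) s%:R^-1.
  by apply: le_trans (H T (leqnn T)); rewrite lerDl mulr_ge0 ?dot_ge0.
elim: t => [_|t IH tT]; first by rewrite !big_geq// mul0r mulr0.
have {IH} := IH (ltnW tT).
rewrite !(big_nat_recr t.+1)//=.
have N0 : 0 < t.+1%:R :> R by rewrite ltr0n.
(* Recursive form of the mean. For [t = 0] the step has length 1 and lands on [a 1] wherever [w 1]
   is. *)
have -> : c t.+1 = w t.+1 + t.+1%:R^-1 *: (a t.+1 - w t.+1).
  rewrite /c (big_nat_recr t.+1)//=; case: t tT {N0} => [_|t tT].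
    by rewrite big_geq// invr1 !scale1r add0r addrC subrK.
  rewrite wE ?tT//.
  move: (\sum_(_ <= _ < _) _) (a _) => S b.
  apply/rowP => i; rewrite !mxE -!natr1; field.
  by rewrite addrK !natr1 !pnatr_eq0.
(* At [t = 0] the factor annihilates both sides; afterwards [w t.+1] is the mean [c t]. *)
have -> : t%:R * dot (y - c t) (y - c t)
    = t%:R * dot (y - w t.+1) (y - w t.+1).
  case: t tT {N0} => [|t] tT; first by rewrite !mul0r.
  by rewrite wE ?tT// -[t.+2%:R]natr1 addrK.
have /(ler_wpM2r (_ : 0 <= t.+1%:R^-1)) := aD t.+1 tT.
rewrite invr_ge0 ler0n => /(_ isT).
move: (a _) (w _) => b z.
have tE : t%:R = t.+1%:R - 1 :> R by rewrite -natr1 addrK.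
rewrite tE; set N := t.+1%:R in N0 *.
(* Exact balance of one round: the excess over the cost of [y] is |b - z|^2 / N, at most [D2 / N],
   whence the harmonic sum. *)
have : N * dot (y - (z + N^-1 *: (b - z))) (y - (z + N^-1 *: (b - z)))
   + dot (b - z) (b - z) =
  (N - 1) * dot (y - z) (y - z) + dot (b - y) (b - y)
   + dot (b - z) (b - z) * N^-1.
  rewrite !dotE (dotC y b) (dotC z b) (dotC z y); field.
  by rewrite gt_eqF.
rewrite mulrDr; move: N N0 {tE} => N N0.
move: (\sum_(1 <= s < t.+1) dot (a s - w s) (a s - w s)) => U.
move: (\sum_(1 <= s < t.+1) dot (a s - y) (a s - y)) => V.
move: (D2 * \sum_(_ <= _ < _) _) (D2 / N) => r s.
move: (dot (b - z) (b - z) / N) => p1.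
move: (dot (y - (z + _)) _) (dot (b - z) _) => p2 p3.
move: (dot (b - y) _) (dot (y - z) _) => p4 p5; lra.
Qed.

End follow_the_leader.

(** * Optimistic gradient descent within one game: total regret and welfare *)

Section optimistic_gradient.
Context {R : realType} {n : nat} {d : 'I_n -> nat}.
Context {X : forall k : 'I_n, set 'rV[R]_(d k)}.
Arguments X : clear implicits.
Implicit Types (G : @game R n d) (x y : @profile R n d).

Local Notation sqn u := (dot u u).

(** The Lipschitz bound for player [k] involves the moves of all players but [k]; summed over [k],
    each move is counted [n - 1] times. *)
Lemma lipschitz_utility_vec G (L : R) x y :
  (0 < n)%N -> lipschitz_game X G L -> profiles X x -> profiles X y ->
  \sum_(k < n) sqn (utility_vec G x k - utility_vec G y k) <=
    L ^+ 2 * (n%:R - 1) * \sum_(k < n) sqn (x k - y k).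
Proof.
move=> n0 [L0 GL] Xx Xy.
have H k : sqn (utility_vec G x k - utility_vec G y k) <=
    L ^+ 2 * (\sum_(j < n) sqn (x j - y j) - sqn (x k - y k)).
  have -> : \sum_(j < n) sqn (x j - y j) - sqn (x k - y k) =
      others_dist (@drop_player R n d x k) (@drop_player R n d y k) ^+ 2.
    rewrite sqr_sqrtr ?sumr_ge0// => [|j _]; last exact: sqr_ge0.
    rewrite (bigD1 k)//= addrAC subrr add0r.
    rewrite (eq_bigl (fun j => j \in [pred j | j != k]))//.
    by rewrite big_sub; apply: eq_bigr => j _; rewrite norm2_sqr.
  rewrite -norm2_sqr -exprMn ler_sqr ?nnegrE ?norm2_ge0 ?mulr_ge0 ?sqrtr_ge0//.
    by apply: GL => j; [exact: Xx|exact: Xy].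
  exact: ltW.
apply: le_trans (ler_sum _ (fun k _ => H k)) _.
rewrite -mulr_sumr sumrB sumr_const card_ord -mulrA.
by rewrite mulrBl mul1r mulr_natl.
Qed.

Lemma lipschitz_game_le G (L L' : R) :
  L <= L' -> lipschitz_game X G L -> lipschitz_game X G L'.
Proof.
move=> LL [L0 GL]; split=> [|k y z yX zX]; first exact: lt_le_trans LL.
apply: le_trans (GL _ _ _ yX zX) _.
by rewrite ler_wpM2r ?sqrtr_ge0.
Qed.

Hypothesis X0 : forall k, X k !=set0.
Hypothesis cX : forall k, compact (X k).
Hypothesis convX : forall k, @convex_set R 'rV[R]_(d k) (X k).

Lemma ogdS1 G eta x0 i k : (ogd X G eta x0 i.+1).1 k =
  Defs.proj (X k) ((ogd X G eta x0 i).2 k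
    + eta *: utility_vec G (ogd X G eta x0 i).1 k).
Proof. by rewrite /=; case: ogd. Qed.

Lemma ogdS2 G eta x0 i k : (ogd X G eta x0 i.+1).2 k =
  Defs.proj (X k) ((ogd X G eta x0 i).2 k
    + eta *: utility_vec G (ogd X G eta x0 i.+1).1 k).
Proof. by rewrite /=; case: ogd. Qed.

Lemma ogd_profiles G eta x0 i :
  profiles X x0 -> profiles X (ogd X G eta x0 i).1.
Proof. by case: i => // i _ k; rewrite ogdS1; exact: proj_in. Qed.

(* The sum of the regrets is bounded although the individual ones need not be:
   the step size makes the total squared variation of the utilities smaller
   than the total movement of the iterates. *)
Lemma ogd_regret G (L eta : R) x0 z m
    (x := fun i => (ogd X G eta x0 i).1) :
  (0 < n)%N -> lipschitz_game X G L -> profiles X x0 -> profiles X z ->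
  eta ^+ 2 * (L ^+ 2 * (n%:R - 1)) <= 16^-1 ->
  eta * \sum_(k < n) \sum_(1 <= i < m.+1)
      dot (z k - x i k) (utility_vec G (x i) k) <=
    2^-1 * \sum_(k < n) sqn (z k - x0 k).
Proof.
move=> n0 GL Xx0 Xz etaL; pose h i := (ogd X G eta x0 i).2.
(* The induction must keep two negative terms: the first telescopes, and the second pays for part of
   the prediction error of the next iteration. *)
suff : eta * \sum_(k < n) \sum_(1 <= i < m.+1)
      dot (z k - x i k) (utility_vec G (x i) k) <=
    2^-1 * (\sum_(k < n) sqn (z k - x0 k) - \sum_(k < n) sqn (z k - h m k))
    - 4^-1 * \sum_(k < n) sqn (h m k - x m k).
  have : 0 <= \sum_(k < n) sqn (z k - h m k).
    by apply: sumr_ge0 => k _; exact: dot_ge0.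
  have : 0 <= \sum_(k < n) sqn (h m k - x m k).
    by apply: sumr_ge0 => k _; exact: dot_ge0.
  lra.
elim: m => [|m IH].
  rewrite big1 ?mulr0 => [|k _]; last by rewrite big_geq.
  rewrite subrr mulr0.
  rewrite (_ : \sum_(k < n) sqn (h 0%N k - x 0%N k) = 0) ?mulr0 ?subr0//.
  by apply: big1 => k _; rewrite /h /x /= subrr -(scale0r 0) dotZl mul0r.
under eq_bigr do rewrite (big_nat_recr m.+1)//=.
rewrite big_split/= mulrDr.
have step : eta * \sum_(k < n)
      dot (z k - x m.+1 k) (utility_vec G (x m.+1) k) <=
    2^-1 * (\sum_(k < n) sqn (z k - h m k) - \sum_(k < n) sqn (z k - h m.+1 k))
    + eta ^+ 2 * \sum_(k < n)
        sqn (utility_vec G (x m.+1) k - utility_vec G (x m) k)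
    - 4^-1 * \sum_(k < n) sqn (h m.+1 k - x m.+1 k)
    - 2^-1 * \sum_(k < n) sqn (x m.+1 k - h m k).
  rewrite -sumrB !mulr_sumr -big_split/= -!sumrB.
  apply: ler_sum => k _.
  have := optimistic_step (X0 k) (@cX k) (@convX k) eta (h m k)
    (utility_vec G (x m) k) (utility_vec G (x m.+1) k) (Xz k).
  by rewrite -ogdS1 -ogdS2.
(* The factor [8^-1] is the [16^-1] of the step-size condition times the 2 of [move_le]. Of its two
   sums, one is absorbed by the [2^-1] movement term of [step], the other by the [4^-1] term of the
   induction hypothesis. *)
have variation : eta ^+ 2 * \sum_(k < n)
      sqn (utility_vec G (x m.+1) k - utility_vec G (x m) k) <=
    8^-1 * (\sum_(k < n) sqn (x m.+1 k - h m k)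
      + \sum_(k < n) sqn (h m k - x m k)).
  have move_le : \sum_(k < n) sqn (x m.+1 k - x m k) <=
      2 * (\sum_(k < n) sqn (x m.+1 k - h m k)
        + \sum_(k < n) sqn (h m k - x m k)).
    rewrite -big_split mulr_sumr; apply: ler_sum => k _.
    exact: dot_parallelogram_le.
  have := lipschitz_utility_vec n0 GL
    (ogd_profiles G eta m.+1 Xx0) (ogd_profiles G eta m Xx0).
  move=> /(ler_wpM2l (sqr_ge0 eta)); rewrite mulrA -/(x _) -/(x _).
  have S0 : 0 <= \sum_(k < n) sqn (x m.+1 k - x m k).
    by apply: sumr_ge0 => k _; exact: dot_ge0.
  have := ler_wpM2r S0 etaL; lra.
have P0 : 0 <= \sum_(k < n) sqn (x m.+1 k - h m k).
  by apply: sumr_ge0 => k _; exact: dot_ge0.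
have Q0 : 0 <= \sum_(k < n) sqn (h m k - x m k).
  by apply: sumr_ge0 => k _; exact: dot_ge0.
lra.
Qed.

(** Since [z] is optimal in hindsight, the regret against it dominates the regret against the
    smoothness profile. Smoothness then gives m lam OPT - mu S <= Reg + S for the total welfare S,
    with Reg at most the squared distances over 2 eta, and 1/(2 eta) is the displayed
    coefficient. *)
Lemma ogd_welfare G (L lam mu : R) x0 z m
    (eta := (4 * L * Num.sqrt (n%:R - 1))^-1)
    (x := fun i => (ogd X G eta x0 i).1) :
  (2 <= n)%N -> lipschitz_game X G L -> smooth X G lam mu ->
  profiles X x0 ->
  (forall k, argmax (X k) (fun v =>
     \sum_(1 <= i < m.+1) dot v (utility_vec G (x i) k)) (z k)) ->
  m%:R * (lam / (1 + mu) * OPT X G)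
    - 2 * L * Num.sqrt (n%:R - 1) * \sum_(k < n) sqn (z k - x0 k) <=
  \sum_(1 <= i < m.+1) welfare G (x i).
Proof.
move=> n2 GL [lam0 mu0 [xs Xxs xsP]] Xx0 zmax.
have L0 : 0 < L by case: GL.
have s0 : 0 < Num.sqrt (n%:R - 1) :> R.
  by rewrite sqrtr_gt0 subr_gt0 ltr1n.
have ss : Num.sqrt (n%:R - 1) ^+ 2 = n%:R - 1 :> R.
  by rewrite sqr_sqrtr// subr_ge0 ler1n ltnW.
have n0 : (0 < n)%N by rewrite ltnW.
have Xz : profiles X z by move=> k; case: (zmax k).
(* Equality holds for this [eta]. *)
have etaL : eta ^+ 2 * (L ^+ 2 * (n%:R - 1)) <= 16^-1.
  rewrite -ss /eta; set s := Num.sqrt _ in s0 *.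
  rewrite le_eqVlt; apply/orP; left; apply/eqP; field.
  by rewrite !gt_eqF.
have := ogd_regret m n0 GL Xx0 Xz etaL; rewrite -/x.
set B := \sum_(k < n) sqn _.
have B0 : 0 <= B by apply: sumr_ge0 => k _; exact: dot_ge0.
set Reg := (X in eta * X); rewrite /eta mulrC ler_pdivrMr ?mulr_gt0// => reg.
set S := \sum_(1 <= i < m.+1) _.
have smoothS : m%:R * (lam * OPT X G) - mu * S <=
    \sum_(1 <= i < m.+1) \sum_(k < n) dot (xs k) (utility_vec G (x i) k).
  rewrite mulr_sumr -[m in m%:R]subn0 -subSS mulr_natl -sumr_const_nat -sumrB.
  by apply: ler_sum => i _; apply: xsP; exact: ogd_profiles.
have best : \sum_(1 <= i < m.+1) \sum_(k < n) dot (xs k) (utility_vec G (x i) k)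
    <= Reg + S.
  rewrite exchange_big [S]exchange_big -big_split; apply: ler_sum => k _ /=.
  rewrite -big_split/= (le_trans ((zmax k).2 _ (Xxs k)))//.
  by apply: ler_sum => i _; rewrite !dotE subrK.
have mu1 : 0 < 1 + mu by rewrite addr_gt0.
rewrite -(ler_pM2l mu1) mulrBr.
have -> : (1 + mu) * (m%:R * (lam / (1 + mu) * OPT X G)) =
    m%:R * (lam * OPT X G).
  by field; rewrite gt_eqF.
have C0 : 0 <= 2 * L * Num.sqrt (n%:R - 1) * B.
  by rewrite !mulr_ge0// ltW.
(* The error actually obtained is divided by [1 + mu]; this nonnegative slack drops the division. *)
have := mulr_ge0 (ltW mu0) C0.
lra.
Qed.

End optimistic_gradient.

(** * Cost of the initializations and summation over the games *)

(** The follow-the-leader bound holds against every fixed [y] in [X k], so the infimum over [y] may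
    be taken; the factor [T] cancels the normalization in [deviation2]. *)
Lemma deviation2_initialization (R : realType) (n : nat) (d : 'I_n -> nat)
    (X : forall k : 'I_n, set 'rV[R]_(d k)) (T : nat)
    (x0 opt : nat -> @profile R n d) (k : 'I_n) :
  (0 < T)%N -> X k !=set0 -> compact (X k) ->
  (forall t, (1 <= t <= T)%N -> X k (x0 t k)) ->
  (forall t, (1 <= t <= T)%N -> X k (opt t k)) ->
  (forall t, (2 <= t <= T)%N ->
    x0 t k = (t%:R - 1)^-1 *: \sum_(1 <= s < t) opt s k) ->
  \sum_(1 <= t < T.+1) dot (opt t k - x0 t k) (opt t k - x0 t k) <=
    T%:R * deviation2 X T opt k + diam (X k) ^+ 2 * (1 + ln T%:R).
Proof.
move=> T0 Xk0 cXk Xx0 Xopt x0E.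
have TR : T%:R != 0 :> R by rewrite pnatr_eq0 -lt0n.
rewrite /deviation2 mulrA divff// mul1r -lerBlDr; apply: lb_le_inf.
  by case: Xk0 => y Xy; eexists; exists y.
move=> _ [y Xy <-]; rewrite lerBlDr.
under [X in _ <= X + _]eq_bigr do rewrite norm2_sqr.
apply: le_trans (@follow_the_leader_quadratic R (d k) (opt^~ k) (x0^~ k)
  (diam (X k) ^+ 2) T y _ x0E) _.
  by move=> t tT; apply: sqdist_le_diam => //; [exact: Xopt|exact: Xx0].
by rewrite lerD2l ler_wpM2l ?sqr_ge0 ?harmonic_le_ln.
Qed.

Theorem theoremB11 (R : realType) :
  exists (P : {poly {poly {poly R}}}) (Q : {poly R}),
  forall (n : nat) (d : 'I_n -> nat) (X : forall k : 'I_n, set 'rV[R]_(d k))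
    (T m : nat) (G : nat -> @game R n d) (lam mu Lip : nat -> R)
    (tie : forall k : 'I_n, ('rV[R]_(d k) -> R) -> 'rV[R]_(d k))
    (x0 opt : nat -> @profile R n d),
  (2 <= n)%N -> (0 < T)%N -> (0 < m)%N ->
  (forall k, [/\ X k !=set0, @convex_set R 'rV[R]_(d k) (X k)
                & compact (X k)]) ->
  (forall t, (1 <= t <= T)%N ->
    [/\ valid_game X (G t), lipschitz_game X (G t) (Lip t)
      & smooth X (G t) (lam t) (mu t)]) ->
  tie_breaking X tie ->
  let L := \big[Num.max/0]_(1 <= t < T.+1) Lip t in
  let eta := (4 * L * Num.sqrt (n%:R - 1))^-1 in
  let x (t i : nat) := (ogd X (G t) eta (x0 t) i).1 in
  (forall t k, (1 <= t <= T)%N ->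
    opt t k = tie k (fun y =>
      \sum_(1 <= i < m.+1) dot y (utility_vec (G t) (x t i) k))) ->
  (forall k, argmin (X k) (fun y => 2^-1 * norm2 y ^+ 2) (x0 1%N k)) ->
  (forall t k, (2 <= t <= T)%N ->
    x0 t k = (t%:R - 1)^-1 *: \sum_(1 <= s < t) opt s k) ->
  (m%:R * T%:R)^-1 *
      \sum_(1 <= t < T.+1) \sum_(1 <= i < m.+1) welfare (G t) (x t i)
  >= T%:R^-1 * (\sum_(1 <= t < T.+1) lam t / (1 + mu t) * OPT X (G t))
     - 2 * L * Num.sqrt (n%:R - 1) / m%:R
         * \sum_(k < n) deviation2 X T opt k
     - eval3 P n%:R L (max_diam X) * Q.[ln T%:R] / (m%:R * T%:R).
Proof.
(* 2 n^2 L D^2 (1 + ln T) *)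
exists (2 * 'X^2 * ('X)%:P * ('X^2)%:P%:P), (1 + 'X).
move=> n d X T m G lam mu Lip tie x0 opt n2 T0 m0 Xall Gall tieP L eta x optE
  x01 x0E.
have X0 k : X k !=set0 by case: (Xall k).
have cX k : compact (X k) by case: (Xall k).
have convX k : @convex_set R 'rV[R]_(d k) (X k) by case: (Xall k).
have optP t : (1 <= t <= T)%N -> forall k, argmax (X k) (fun y =>
    \sum_(1 <= i < m.+1) dot y (utility_vec (G t) (x t i) k)) (opt t k).
  move=> tT k; rewrite optE//; apply: tieP.
  (* The rule [tie] is constrained only where a maximizer exists; here the objective is linear,
     hence attains its maximum on the compact [X k]. *)
  have [c cmax] := argmax_linear_neq0 (X0 k) (@cX k)
    (\sum_(1 <= i < m.+1) utility_vec (G t) (x t i) k).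
  exists c; rewrite /argmax/=; split; first by case: cmax.
  by move=> y /(cmax.2 y); rewrite !dot_sumr.
have Xopt t k : (1 <= t <= T)%N -> X k (opt t k).
  by move=> /optP /(_ k)[].
have Xx0 t k : (1 <= t <= T)%N -> X k (x0 t k).
  case: t => [//|[_|t /andP[_ tT]]]; first by case: (x01 k).
  rewrite x0E// -[t.+2%:R]natr1 addrK; apply: convex_mean => // s /andP[s1 st].
  by apply: Xopt; rewrite s1 (leq_trans st) ?(ltnW tT).
have LipL t : (1 <= t <= T)%N -> Lip t <= L.
  by move=> tT; apply: le_bigmax_seq => //; rewrite mem_index_iota ltnS.
have L0 : 0 < L.
  have [_ [L1 _] _] := Gall 1%N T0.
  by apply: lt_le_trans L1 _; exact: LipL.
set s := Num.sqrt (n%:R - 1).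
have n1 : 1 <= n%:R :> R by rewrite ler1n ltnW.
have s0 : 0 <= s by exact: sqrtr_ge0.
(* The square root is not polynomial in [n]; this crude bound lets [P] have the factor [n^2] in the
   remainder. *)
have sn : s <= n%:R.
  rewrite -ler_sqr ?nnegrE ?ler0n// sqr_sqrtr ?subr_ge0//.
  nra.
pose D := max_diam X.
have DX k : diam (X k) ^+ 2 <= D ^+ 2.
  have diam0 : 0 <= diam (X k).
    have [y Xy] := X0 k.
    exact: le_trans (norm2_ge0 _) (norm2_le_diam (X0 k) (@cX k) Xy Xy).
  have diamD : diam (X k) <= D by exact: le_bigmax.
  by rewrite ler_sqr ?nnegrE// (le_trans diam0).
have game t : (1 <= t <= T)%N ->
    m%:R * (lam t / (1 + mu t) * OPT X (G t)) - 2 * L * s *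
      \sum_(k < n) dot (opt t k - x0 t k) (opt t k - x0 t k) <=
    \sum_(1 <= i < m.+1) welfare (G t) (x t i).
  move=> tT; have [_ GL Gs] := Gall t tT.
  apply: ogd_welfare => //; first exact: lipschitz_game_le (LipL t tT) GL.
    by move=> k; exact: Xx0.
  exact: optP.
set V := \sum_(k < n) deviation2 X T opt k.
have lnT0 : 0 <= 1 + ln T%:R :> R by rewrite addr_ge0// ln_ge0// ler1n.
have init : \sum_(1 <= t < T.+1)
      \sum_(k < n) dot (opt t k - x0 t k) (opt t k - x0 t k) <=
    T%:R * V + n%:R * (D ^+ 2 * (1 + ln T%:R)).
  have -> : n%:R * (D ^+ 2 * (1 + ln T%:R)) =
      \sum_(k < n) D ^+ 2 * (1 + ln T%:R).
    by rewrite sumr_const card_ord mulr_natl.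
  rewrite exchange_big/= mulr_sumr -big_split; apply: ler_sum => k _ /=.
  apply: le_trans (deviation2_initialization T0 (X0 k) (@cX k) _ _ _) _.
  - by move=> t; exact: Xx0.
  - by move=> t; exact: Xopt.
  - by move=> t tT; exact: x0E.
  - by rewrite lerD2l ler_wpM2r.
set SW := \sum_(1 <= t < T.+1) \sum_(_ <= i < _) _.
set O := \sum_(1 <= t < T.+1) _ * _.
have total : m%:R * O - 2 * L * s * (T%:R * V + n%:R * (D ^+ 2 * (1 + ln T%:R)))
    <= SW.
  have B0 : 0 <= 2 * L * s by rewrite !mulr_ge0// ltW.
  apply: le_trans (lerB (lexx _) (ler_wpM2l B0 init)) _.
  rewrite !mulr_sumr -sumrB [X in X <= _]big_nat [SW]big_nat.
  by apply: ler_sum => t /andP[t1 tT]; apply: game; rewrite t1.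
have mR : 0 < m%:R :> R by rewrite ltr0n.
have TR : 0 < T%:R :> R by rewrite ltr0n.
have -> : eval3 (2 * 'X^2 * ('X)%:P * ('X^2)%:P%:P) n%:R L (max_diam X)
    = 2 * n%:R ^+ 2 * L * D ^+ 2.
  by rewrite /eval3 !hornerE.
have -> : (1 + 'X).[ln T%:R] = 1 + ln T%:R :> R by rewrite !hornerE.
have rem : 2 * L * s * (n%:R * (D ^+ 2 * (1 + ln T%:R))) <=
    2 * n%:R ^+ 2 * L * D ^+ 2 * (1 + ln T%:R).
  have Q0 : 0 <= 2 * L * (n%:R * (D ^+ 2 * (1 + ln T%:R))).
    have D0 := sqr_ge0 D; do !apply: mulr_ge0 => //; exact: ltW.
  have := ler_wpM2r Q0 sn; lra.
(* Clearing the denominator [m T] leaves [total], up to the replacement of [s] by [n] in the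
   logarithmic term. *)
rewrite -(ler_pM2l (mulr_gt0 mR TR)) [leRHS]mulrA divff ?mul1r; last first.
  by rewrite gt_eqF ?mulr_gt0.
apply: le_trans total.
move: (1 + ln _) rem => rT rem.
have -> : m%:R * T%:R * (T%:R^-1 * O - 2 * L * s / m%:R * V
     - 2 * n%:R ^+ 2 * L * D ^+ 2 * rT / (m%:R * T%:R)) =
  m%:R * O - 2 * L * s * (T%:R * V) - 2 * n%:R ^+ 2 * L * D ^+ 2 * rT.
  by field; rewrite !gt_eqF.
by rewrite mulrDr opprD addrA lerB ?lexx ?rem.
Qed.
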